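(* Let $P=(\varphi_n)_{n=0}^\infty$ be a sequence with $\varphi_0\in\mathbb{N}$ a constant and $\varphi_n\colon\mathbb{N}^n\to\mathbb{N}$ for $n\in\mathbb{N}$. Let the positive Perron expansion ($P$-representation) and the alternating Perron expansion ($P^-$-representation) be determined by this same sequence $P$. Then for every set $\mathfrak{M}\subset\mathbb{N}^{\mathbb{N}}$, $$\dim_H\left\{x\in(0,1]\colon (p_n(x))_{n=1}^\infty\in\mathfrak{M}\right\}=\dim_H\left\{x\in(0,1)\setminus IS^{P^-}\colon (q_n(x))_{n=1}^\infty\in\mathfrak{M}\right\},$$ where $p_n(x)$ and $q_n(x)$ denote the $n$th digits of the positive and of the alternating Perron expansion of $x$, respectively, and $\dim_H$ is the classical Hausdorff dimension.
   Context: $\mathbb{N}=\{1,2,3,\dots\}$. Fix $P=(\varphi_n)_{n\ge 0}$ as in the claim. The $P$-representation of $x\in(0,1]$ is the representation $$x=\frac{r_0}{p_1}+\sum_{n=1}^{\infty}\frac{r_0\cdots r_n}{(p_1-1)p_1\cdots(p_n-1)p_n\,p_{n+1}},$$ where $r_0=\varphi_0$, $r_n=\varphi_n(p_1,\ldots,p_n)$ for $n\ge1$, and $(p_n)_{n\ge1}$ is a sequence of natural numbers with $p_n\ge r_{n-1}+1$ for all $n\in\mathbb{N}$. Every $x\in(0,1]$ has exactly one $P$-representation; its digits are denoted $p_n=p_n(x)$. The $P^-$-representation of $x$ is the representation $$x=\frac{r_0}{q_1-1}+\sum_{n=1}^{\infty}\frac{(-1)^n r_0\cdots r_n}{(q_1-1)q_1\cdots(q_n-1)q_n(q_{n+1}-1)},$$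 where $r_0=\varphi_0$, $r_n=\varphi_n(q_1,\ldots,q_n)$ for $n\ge1$, and $(q_n)_{n\ge1}$ is a sequence of natural numbers with $q_n\ge r_{n-1}+1$ for all $n\in\mathbb{N}$. Every $x\in(0,1]$ has at most one $P^-$-representation; its digits, when it exists, are denoted $q_n=q_n(x)$. $IS^{P^-}$ denotes the (countable) set of all numbers in $(0,1]$ that have no $P^-$-representation. *)

(* Defs.v *)
From HB Require Import structures.
From mathcomp Require Import all_boot all_order all_algebra.
From mathcomp Require Import all_classical all_reals all_analysis.
Set Implicit Arguments.
Unset Strict Implicit.
Unset Printing Implicit Defensive.
Import Order.TTheory GRing.Theory Num.Theory.
Import numFieldNormedType.Exports.
Local Open Scope classical_set_scope.
Local Open Scope ring_scope.

(* The natural numbers of the theory of Perron expansions start at 1. *)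
Definition posnat : Type := {n : nat | (0 < n)%N}.

Definition posnat_val (n : posnat) : nat := sval n.
Coercion posnat_val : posnat >-> nat.

Definition posnat1 : posnat := exist (fun n : nat => (0 < n)%N) 1%N (erefl true).

(* Digit sequences (p_1, p_2, ...) are functions [p : nat -> posnat] with the
   indices shifted by one: [p n] is the digit p_(n+1).  The sequence
   (varphi_n) is [phi : forall n, n.-tuple posnat -> posnat]; as [0.-tuple posnat]
   has exactly one element, [phi 0] is a constant. *)
Section PerronExpansions.
Variable R : realType.
Variable phi : forall n : nat, n.-tuple posnat -> posnat.

(* r_n = varphi_n(p_1, ..., p_n) *)
Definition perron_r (p : nat -> posnat) (n : nat) : posnat :=
  phi [tuple p i | i < n].

(* p_(n+1) >= r_n + 1 for all n >= 0 *)
Definition perron_admissible (p : nat -> posnat) : Prop :=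
  forall n : nat, (perron_r p n + 1 <= p n)%N.

(* r_0 ... r_n / ((p_1 - 1) p_1 ... (p_n - 1) p_n p_(n+1)) *)
Definition perron_term (p : nat -> posnat) (n : nat) : R :=
  (\prod_(k < n.+1) (perron_r p k)%:R) /
  ((\prod_(k < n) (((p k)%:R - 1) * (p k)%:R)) * (p n)%:R).

(* (-1)^n r_0 ... r_n / ((q_1 - 1) q_1 ... (q_n - 1) q_n (q_(n+1) - 1)) *)
Definition alt_perron_term (q : nat -> posnat) (n : nat) : R :=
  ((-1) ^+ n * \prod_(k < n.+1) (perron_r q k)%:R) /
  ((\prod_(k < n) (((q k)%:R - 1) * (q k)%:R)) * ((q n)%:R - 1)).

Definition is_perron_repr (x : R) (p : nat -> posnat) : Prop :=
  perron_admissible p /\ series (perron_term p) @ \oo --> x.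

Definition is_alt_perron_repr (x : R) (q : nat -> posnat) : Prop :=
  perron_admissible q /\ series (alt_perron_term q) @ \oo --> x.

(* The default value of [xget] is never used on (0, 1], where the
   representation exists and is unique. *)
Definition perron_digits (x : R) : nat -> posnat :=
  xget (fun=> posnat1) [set p | is_perron_repr x p].

(* IS^{P^-}: the points of (0, 1] without a P^- -representation *)
Definition alt_perron_IS : set R :=
  [set x | 0 < x <= 1 /\ ~ exists q, is_alt_perron_repr x q].

(* Meaningful on (0, 1] outside [alt_perron_IS]; constant 1 sequence on
   [alt_perron_IS]. *)
Definition alt_perron_digits (x : R) : nat -> posnat :=
  xget (fun=> posnat1) [set q | is_alt_perron_repr x q].

End PerronExpansions.

Section HausdorffDimension.
Variable R : realType.
Local Open Scope ereal_scope.

(* Adjoining 0 only matters for the empty set, whose diameter is then 0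
   instead of [ereal_sup set0 = -oo]. *)
Definition diameter (U : set R) : \bar R :=
  ereal_sup ([set 0] `|` [set (`|x - y|%R)%:E | x in U & y in U]).

(* H^s_delta(A).  Empty members of a cover contribute 0 and, since [poweR]
   satisfies 0 `^ 0 = 1, nonempty ones contribute 1 when s = 0, so that H^0 is
   the counting measure; finite covers are obtained by padding with set0. *)
Definition hausdorff_content (s delta : R) (A : set R) : \bar R :=
  ereal_inf [set \sum_(i <oo | U i != set0) (diameter (U i) `^ s) |
    U in [set U : nat -> set R | A `<=` \bigcup_i U i /\
                                 forall i, diameter (U i) <= delta%:E]].

(* H^s(A), the limit of H^s_delta(A) as delta decreases to 0; by monotonicity
   in delta this is a supremum. *)
Definition hausdorff_measure (s : R) (A : set R) : \bar R :=
  ereal_sup [set hausdorff_content s delta A |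
    delta in [set delta : R | (0 < delta)%R]].

Definition hausdorff_dim (A : set R) : \bar R :=
  ereal_inf [set s%:E |
    s in [set s : R | (0 <= s)%R /\ hausdorff_measure s A = 0]].

End HausdorffDimension.

(* Main.v *)
Require Import Defs.
From mathcomp Require Import all_boot all_order all_algebra.
From mathcomp Require Import all_classical all_reals all_analysis.
From mathcomp Require Import ring lra.
Import Order.TTheory GRing.Theory Num.Theory.
Import numFieldNormedType.Exports.
Set Implicit Arguments.
Unset Strict Implicit.
Unset Printing Implicit Defensive.
Local Open Scope classical_set_scope.
Local Open Scope ring_scope.

(** Both expansions refine (0, 1] by the same tree of cylinder intervals, up to
    reflections.  Number the digits from 0 and let c_n be the product of
    r_k / ((p_k - 1) p_k) over k < n.  The numbers whose first n digits are
    p_0, ..., p_(n-1) lie in an interval of length c_n, starting at the n-th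
    partial sum; the positive expansion always runs through it in the same
    direction, the alternating one reverses direction at every rank.  The position t_n in [0, 1] inside this interval
    satisfies, in both cases,
      t_n = r_n / p_n + r_n / ((p_n - 1) p_n) * t',
    where t' is t_(n+1) for the positive and 1 - t_(n+1) for the alternating
    expansion ([tailS]).  A boolean selects the expansion: false is the
    positive one, true the alternating one.

    The correspondence between the values of the same digit sequence in the two
    expansions is not Lipschitz, because two adjacent cylinders are glued along
    different ends: numbers close to each other on both sides of a common end
    point may be sent far apart.  It is nevertheless Lipschitz after splitting
    into a bounded number of pieces.  If a set of values has diameter d, then
    its digit sequences can be split into three parts on each of which the
    values in the other expansion have diameter at most 6 d
    ([cover_transfer]).  Let n be the first rank where the sequences disagree
    and a the least digit there.  If a digit >= a + 2 occurs, the gap between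
    the two cylinders is comparable with the whole stretch that they span, and
    one part is enough ([far_close]).  Otherwise there are two adjacent
    cylinders and all points are within d of their common end ([near_close]).
    Points near the bottom of a cylinder (t small) have a digit that is large compared
    with r_n, so they are near the bottom in the other expansion as well
    ([near_bottom]).  Points near the top (t close to 1) stay near the top
    unless their digit is the minimal one, r_n + 1; this subcylinder has to be
    examined at the next rank ([near_top]).

    A correspondence of this kind preserves the nullity of every Hausdorff
    measure ([hausdorff_null_transfer]), hence the dimension.  The two sets of
    the theorem are the values of the admissible sequences in M
    ([perron_set_image], [alt_perron_set_image]); for the positive expansion
    this includes the existence of the expansion, by a greedy algorithm. *)

(** * Hausdorff measures of sets that correspond piecewise Lipschitz *)

Section Hausdorff.
Variable R : realType.
Implicit Types (U A : set R) (s d : R).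

Lemma diameter_ge0 U : (0 <= diameter U)%E.
Proof. by apply: ereal_sup_ubound; left. Qed.

Lemma diameter_ge U x y : U x -> U y -> (`|x - y|%:E <= diameter U)%E.
Proof.
by move=> Ux Uy; apply: ereal_sup_ubound; right; exists x => //; exists y.
Qed.

Lemma diameter_le U d : 0 <= d ->
  (forall x y, U x -> U y -> `|x - y| <= d) -> (diameter U <= d%:E)%E.
Proof.
move=> d0 Ud; apply: ge_ereal_sup => _ [->|[x Ux [y Uy <-]]]; rewrite lee_fin//.
exact: Ud.
Qed.

Lemma hausdorff_content_ge0 s d A : (0 <= hausdorff_content s d A)%E.
Proof.
apply: le_ereal_inf_tmp => _ [U _ <-]; apply: nneseries_ge0 => i _ _.
exact: poweR_ge0.
Qed.

Lemma hausdorff_measure_eq0 s A : hausdorff_measure s A = 0%E <->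
  forall d, 0 < d -> (hausdorff_content s d A <= 0)%E.
Proof.
split=> [H d d0|H]; first by rewrite -H; apply: ereal_sup_ubound; exists d.
apply/eqP; rewrite eq_le; apply/andP; split.
  by apply: ge_ereal_sup => _ [d d0 <-]; exact: H.
apply: le_trans (hausdorff_content_ge0 s 1 A) _.
by apply: ereal_sup_ubound; exists 1 => //=.
Qed.

(** [X] and [Y] are two parametrisations by the points of [D].  A bound on the
    diameter of a piece of [X @` D] controls [Y] only after the piece has been
    split into [K.+1] parts. *)
Section Transfer.
Variables (T : Type) (D : set T) (X Y : T -> R) (K : nat) (C : R).
Hypothesis C0 : 0 < C.
Hypothesis split_cover : forall (S : set T) d, 0 <= d -> S `<=` D ->
  (forall p q, S p -> S q -> `|X p - X q| <= d) ->
  exists F : nat -> set T, S `<=` \bigcup_(j in `I_K.+1) F j /\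
    forall j p q, F j p -> F j q -> `|Y p - Y q| <= C * d.

Lemma sum_divn (g : nat -> R) n :
  \sum_(0 <= k < n * K.+1) g (k %/ K.+1)%N = K.+1%:R * \sum_(0 <= i < n) g i.
Proof.
rewrite big_nat_mul big_distrr/=; apply: eq_bigr => i _.
rewrite (eq_big_nat _ _ (F2 := fun=> g i)); last first.
  move=> k /andP[ik ki]; congr g; apply/eqP; rewrite eqn_leq.
  by rewrite -ltnS ltn_divLR// ki leq_divRL.
by rewrite big_const_nat -mulnBl subSnn mul1n iter_addr_0 mulr_natl.
Qed.

(** Each member of a cover of [X @` D] is replaced by the [K.+1] images under
    [Y] of its parts; this multiplies the sum of the s-th powers of the
    diameters by at most [K.+1 * C `^ s].  An empty member has only empty
    parts; this matters for s = 0, where every nonempty member of a cover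
    contributes 1, whatever its diameter. *)
Lemma hausdorff_null_transfer s : 0 <= s ->
  hausdorff_measure s (X @` D) = 0%E -> hausdorff_measure s (Y @` D) = 0%E.
Proof.
move=> s0 /hausdorff_measure_eq0 H; apply/hausdorff_measure_eq0 => dl dl0.
apply/lee_addgt0Pr => e e0; rewrite add0e.
have Cs0 : 0 < C `^ s by exact: powR_gt0.
pose e' := e / (K.+1%:R * C `^ s).
have e'0 : 0 < e' by rewrite divr_gt0// mulr_gt0.
have /ereal_inf_lt[_ [U [XU Udl] <-] Ue] :
    (hausdorff_content s (dl / C) (X @` D) < e'%:E)%E.
  apply: (@le_lt_trans _ _ 0%E); last by rewrite lte_fin.
  by apply: H; rewrite divr_gt0.
pose d i := fine (diameter (U i)).
have dE i : diameter (U i) = (d i)%:E.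
  rewrite /d fineK// ge0_fin_numE ?diameter_ge0//.
  exact: le_lt_trans (Udl i) (ltry _).
have d0 i : 0 <= d i by rewrite -lee_fin -dE diameter_ge0.
pose S i := D `&` X @^-1` U i.
have closeS i p q : S i p -> S i q -> `|X p - X q| <= d i.
  by move=> [_ Up] [_ Uq]; rewrite -lee_fin -dE; exact: diameter_ge.
have [F FP] := choice (fun i =>
  @split_cover (S i) (d i) (d0 i) (@subIsetl _ _ _) (closeS i)).
(* member number i * K.+1 + j is the j-th part of the i-th member *)
pose V k := Y @` (S (k %/ K.+1)%N `&` F (k %/ K.+1)%N (k %% K.+1)%N).
have Vd k : (diameter (V k) <= (C * d (k %/ K.+1)%N)%:E)%E.
  apply: diameter_le; first by rewrite mulr_ge0// ltW.
  by move=> _ _ [p [_ Fp] <-] [q [_ Fq] <-]; apply: (FP _).2 Fp Fq.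
pose g i : R := if U i == set0 then 0 else d i `^ s.
have g0 i : 0 <= g i by rewrite /g; case: ifPn => // _; exact: powR_ge0.
apply: (@le_trans _ _ (\sum_(i <oo | V i != set0) diameter (V i) `^ s)%E).
  apply: ereal_inf_lbound; exists V => //; split.
    move=> _ [p Dp <-]; have [|i _ Ui] := XU (X p); first by exists p.
    have [j jK Fj] := (FP i).1 p (conj Dp Ui).
    exists (i * K.+1 + j)%N => //; exists p => //.
    by rewrite /V divnMDl// divn_small// addn0 modnMDl modn_small.
  move=> k; apply: le_trans (Vd k) _; rewrite lee_fin mulrC -ler_pdivlMr//.
  by rewrite -lee_fin -dE.
have Vg k : ((if V k != set0 then diameter (V k) `^ s else 0) <=
    (C `^ s * g (k %/ K.+1)%N)%:E)%E.
  case: ifPn => [/set0P[_ [p [[_ Up] _] _]]|_]; last first.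
    by rewrite lee_fin mulr_ge0// powR_ge0.
  rewrite /g ifF; last by apply/negbTE/set0P; exists (X p).
  rewrite -powRM ?(ltW C0)// -poweR_EFin.
  apply: gt0_ler_poweR => //.
    by rewrite in_itv/= leey andbT diameter_ge0.
  by rewrite in_itv/= leey andbT lee_fin mulr_ge0// ltW.
rewrite eseries_mkcond; apply: lime_le.
  by apply: is_cvg_nneseries => n _ _; case: ifP => // _; exact: poweR_ge0.
apply: nearW => n /=.
apply: le_trans (lee_sum _ (fun k _ => Vg k)) _.
rewrite sumEFin lee_fin -big_distrr/=.
have gU : \sum_(0 <= i < n) g i <= e'.
  rewrite -lee_fin -sumEFin; apply/ltW; apply: le_lt_trans Ue.
  rewrite [leRHS]eseries_mkcond; apply: le_trans (nneseries_lim_ge n _).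
    apply: lee_sum => i _; rewrite /g; case: ifPn => // _.
    by rewrite dE poweR_EFin.
  by move=> i _ _; case: ifP => // _; exact: poweR_ge0.
have gn : \sum_(0 <= k < n) g (k %/ K.+1)%N <= K.+1%:R * \sum_(0 <= i < n) g i.
  rewrite -sum_divn [leRHS](@big_cat_nat _ _ _ n)//=; last by rewrite leq_pmulr.
  by rewrite lerDl sumr_ge0.
apply: (@le_trans _ _ (C `^ s * (K.+1%:R * e'))).
  by rewrite ler_wpM2l ?(ltW Cs0)// (le_trans gn)// ler_wpM2l.
rewrite /e' le_eqVlt; apply/orP; left; apply/eqP; field.
by apply/andP; split; rewrite ?gt_eqF// pnatr_eq0.
Qed.
End Transfer.
End Hausdorff.
(** * Cylinders and tails of the two expansions *)

Section PerronValues.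
Variables (R : realType) (phi : forall n : nat, n.-tuple posnat -> posnat).
Implicit Types (b : bool) (p q w : nat -> posnat) (n : nat).

Local Notation adm := (perron_admissible phi).

Definition numer p n : R := (perron_r phi p n)%:R.
Definition digit p n : R := (p n)%:R.

Definition cyl_len p n : R :=
  \prod_(k < n) (numer p k / ((digit p k - 1) * digit p k)).

(** Position, seen from the lower end of an interval, of a point at position
    [t] from its starting end: the alternating expansion starts a subcylinder
    from the upper end. *)
Definition flip b (t : R) : R := if b then 1 - t else t.
Definition orient b n : R := if b then (-1) ^+ n else 1.

Definition expansion_term b p : nat -> R :=
  if b then alt_perron_term R phi p else perron_term R phi p.

Definition value b p : R := limn (series (expansion_term b p)).

(** Position of the value inside its cylinder of rank [n], relative to the
    length and measured in the direction of the expansion. *)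
Definition tail b p n : R :=
  orient b n * (value b p - series (expansion_term b p) n) / cyl_len p n.

Definition agree n p q := forall k, (k < n)%N -> p k = q k.

Lemma posnat_inj (a c : posnat) : (a = c :> nat) -> a = c.
Proof. by move=> e; apply: val_inj. Qed.

Lemma agree_sym n p q : agree n p q -> agree n q p.
Proof. by move=> e k kn; rewrite e. Qed.

Lemma agreeS n p q : agree n p q -> p n = q n -> agree n.+1 p q.
Proof. by move=> e f k; rewrite ltnS leq_eqVlt => /predU1P[->|/e]. Qed.

Lemma agree_le m n p q : (m <= n)%N -> agree n p q -> agree m p q.
Proof. by move=> mn e k km; apply: e; exact: leq_trans mn. Qed.

Lemma agree_r n p q : agree n p q -> perron_r phi p n = perron_r phi q n.
Proof.
move=> e; rewrite /perron_r; congr (phi _); apply: eq_from_tnth => i.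
by rewrite !tnth_mktuple e.
Qed.

Lemma agree_numer n p q : agree n p q -> numer p n = numer q n.
Proof. by move=> /agree_r e; rewrite /numer e. Qed.

Lemma agree_cyl_len n p q : agree n p q -> cyl_len p n = cyl_len q n.
Proof.
move=> e; apply: eq_bigr => k _.
by rewrite /digit (agree_numer (agree_le (ltnW (ltn_ord k)) e)) e.
Qed.

Lemma numer_ge1 p n : 1 <= numer p n.
Proof. by rewrite ler1n; exact: (svalP (perron_r phi p n)). Qed.

Lemma digit_ge p n : adm p -> numer p n + 1 <= digit p n.
Proof. by move=> /(_ n); rewrite /numer /digit natr1 ler_nat addn1. Qed.

Lemma cyl_lenS p n : cyl_len p n.+1 =
  cyl_len p n * (numer p n / ((digit p n - 1) * digit p n)).
Proof. by rewrite /cyl_len big_ord_recr. Qed.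

Lemma expansion_termE b p n : adm p -> expansion_term b p n =
  orient b n *
  (cyl_len p n * (numer p n / (if b then digit p n - 1 else digit p n))).
Proof.
move=> ap; have dn0 k : digit p k - 1 != 0 /\ digit p k != 0.
  by have := digit_ge k ap; have := numer_ge1 p k; split; apply/eqP; lra.
have prod0 : \prod_(k < n) ((digit p k - 1) * digit p k) != 0.
  by apply/prodf_neq0 => k _; have [? ?] := dn0 k; rewrite mulf_neq0.
have [d1 d2] := dn0 n; rewrite /expansion_term /orient /cyl_len prodf_div.
set N := \prod_(k < n) numer p k; set D := \prod_(k < n) _ in prod0 *.
case: b; rewrite /alt_perron_term /perron_term big_ord_recr/=.
  transitivity ((-1) ^+ n * (N * numer p n) / (D * (digit p n - 1))) => //.
  by field; apply/andP.
transitivity (N * numer p n / (D * digit p n)) => //.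
by field; apply/andP.
Qed.

Lemma edge_split (r d : R) : 1 < d ->
  r / (d - 1) = r / d + r / ((d - 1) * d).
Proof. by move=> d1; field; apply/andP; split; apply/eqP; lra. Qed.

Lemma step_bounds (r d : R) b t : 1 <= r -> r + 1 <= d -> 0 <= t <= 1 ->
  r / d <= r / d + r / ((d - 1) * d) * flip b t <= r / (d - 1).
Proof.
move=> r1 rd t01.
have l0 : 0 <= r / ((d - 1) * d) by rewrite divr_ge0 ?mulr_ge0//; lra.
have f01 : 0 <= flip b t <= 1 by rewrite /flip; case: b; lra.
by rewrite edge_split; [nra|lra].
Qed.

Lemma div_le1 (r d : R) : 1 <= r -> r + 1 <= d -> r / (d - 1) <= 1.
Proof. by move=> r1 rd; rewrite ler_pdivrMr; lra. Qed.

Lemma cyl_len_gt0 p n : adm p -> 0 < cyl_len p n.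
Proof.
move=> ap; apply: prodr_gt0 => k _.
have := digit_ge k ap; have := numer_ge1 p k => r1 rd.
by rewrite divr_gt0 ?mulr_gt0//; lra.
Qed.

Lemma ratio_le (r d : R) : 1 <= r -> r + 1 <= d -> r / ((d - 1) * d) <= 2^-1.
Proof. by move=> r1 rd; rewrite ler_pdivrMr ?mulr_gt0//; nra. Qed.

Lemma cyl_lenS_half p n : adm p -> cyl_len p n.+1 <= cyl_len p n / 2.
Proof.
move=> ap; rewrite cyl_lenS ler_wpM2l ?(ltW (cyl_len_gt0 n ap))//.
exact: ratio_le (numer_ge1 p n) (digit_ge n ap).
Qed.

Lemma cyl_len_le p n : adm p -> cyl_len p n <= 2^-1 ^+ n.
Proof.
move=> ap; elim: n => [|n ih]; first by rewrite /cyl_len big_ord0.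
by apply: le_trans (cyl_lenS_half n ap) _; rewrite exprS; lra.
Qed.

Lemma cyl_len_cvg0 p : adm p -> cyl_len p n @[n --> \oo] --> 0.
Proof.
move=> ap; apply: (@squeeze_cvgr _ _ _ _ (fun=> 0) (GRing.exp 2^-1)).
- by near=> n; rewrite cyl_len_le// ltW// cyl_len_gt0.
- exact: cvg_cst.
- by apply: cvg_expr; rewrite ger0_norm; lra.
Unshelve. all: by end_near. Qed.

Lemma orient_sqr b n : orient b n * orient b n = 1.
Proof. by rewrite /orient; case: b; rewrite ?mulr1// -expr2 sqrr_sign. Qed.

Lemma orientS b n : orient b n.+1 = (if b then -1 else 1) * orient b n.
Proof. by rewrite /orient; case: b; rewrite ?exprS ?mulr1. Qed.

Lemma normr_orient b n : `|orient b n| = 1.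
Proof. by rewrite /orient; case: b; rewrite ?normr_sign ?normr1. Qed.

(** Induction on [j] for all [n] at once: the first step of the expansion moves
    to one end of the subinterval [r / d, r / (d - 1)] of the cylinder, and the
    remaining steps stay in this subinterval, which they enter from that end. *)
Lemma partial_sum_bounds b p n j : adm p ->
  0 <= orient b n * (series (expansion_term b p) (n + j)%N -
                     series (expansion_term b p) n) <= cyl_len p n.
Proof.
move=> ap; elim: j n => [|j ih] n.
  by rewrite addn0 subrr mulr0 lexx ltW// cyl_len_gt0.
have := ih n.+1; rewrite addSnnS.
set S1 := series _ (n + j.+1)%N.
rewrite !seriesEnat /= big_nat_recr//= expansion_termE//.
set S0 := \sum_(0 <= k < n) _; rewrite orientS cyl_lenS.
have c0 := cyl_len_gt0 n ap; set c := cyl_len p n in c0 *.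
have := numer_ge1 p n; set r := numer p n => r1.
have := digit_ge n ap; rewrite -/r; set d := digit p n => rd.
have := orient_sqr b n; set o := orient b n => oo H.
have l0 : 0 < r / ((d - 1) * d) by rewrite divr_gt0 ?mulr_gt0//; lra.
have rd0 : 0 < r / d by rewrite divr_gt0//; lra.
have rdE : r / (d - 1) = r / d + r / ((d - 1) * d) by apply: edge_split; lra.
have rd1 := div_le1 r1 rd; rewrite rdE in rd1.
set l := r / ((d - 1) * d) in H l0 rdE rd1; set u := r / d in rd0 rdE rd1 H.
have e E : o * (S1 - S0) = o * (S1 - (S0 + o * E)) + o * o * E by ring.
case: (b) H => H.
  rewrite rdE in H; rewrite (e (c * (u + l))) oo; set X := S1 - _ in H *.
  by have : 0 <= c * u; nra.
rewrite (e (c * u)) oo; set X := S1 - _ in H *.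
by have : 0 <= c * u; nra.
Qed.

Lemma partial_sum_dist b p m n : adm p -> (m <= n)%N ->
  `|series (expansion_term b p) n - series (expansion_term b p) m|
    <= cyl_len p m.
Proof.
move=> ap mn; have /andP[lb ub] := partial_sum_bounds b m (n - m) ap.
by rewrite -[leLHS]mul1r -(normr_orient b m) -normrM ger0_norm -(subnKC mn).
Qed.

(** The partial sums from rank m on stay in an interval of length
    [cyl_len p m], which tends to 0. *)
Lemma value_cvg b p : adm p -> series (expansion_term b p) @ \oo --> value b p.
Proof.
move=> ap; apply/cauchy_cvgP/cauchy_seriesP => e e0.
have /cvgrPdist_lt/(_ e e0) small := cyl_len_cvg0 ap.
case: small => N _ small; exists ([set n | (N <= n)%N], setT) => //=.
  by split; [exists N|exact: filterT].
move=> [m n] /= [Nm _]; have := small m Nm; rewrite /= sub0r normrN.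
rewrite gtr0_norm ?cyl_len_gt0// => cm.
have [mn|nm] := leqP m n; last by rewrite big_geq ?normr0// ltnW.
apply: le_lt_trans cm; have := partial_sum_dist b ap mn.
by rewrite sub_series mn.
Qed.

Lemma value_bounds b p n : adm p ->
  0 <= orient b n * (value b p - series (expansion_term b p) n) <= cyl_len p n.
Proof.
move=> ap; set A := series (expansion_term b p).
have cA : orient b n * (A m - A n) @[m --> \oo] -->
    orient b n * (value b p - A n).
  by apply: cvgMr; apply: cvgB; [exact: value_cvg|exact: cvg_cst].
have bd m : (n <= m)%N -> 0 <= orient b n * (A m - A n) <= cyl_len p n.
  by move=> nm; rewrite -(subnKC nm); exact: partial_sum_bounds.
apply/andP; split; [apply: (cvgr_to_ge cA)|apply: (cvgr_to_le cA)];
  by exists n => // m /bd /andP[].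
Qed.

Lemma value_tail b p n : adm p ->
  value b p = series (expansion_term b p) n +
              orient b n * (cyl_len p n * tail b p n).
Proof.
move=> ap; have c0 := cyl_len_gt0 n ap.
rewrite /tail [cyl_len p n * _]mulrC divfK ?gt_eqF// mulrA orient_sqr; ring.
Qed.

Lemma tail0 b p : adm p -> tail b p 0 = value b p.
Proof.
move=> ap; rewrite (value_tail b 0 ap) /orient /cyl_len big_ord0 /series/=.
by rewrite big_geq// expr0; case: b; rewrite !mul1r add0r.
Qed.

Lemma tail01 b p n : adm p -> 0 <= tail b p n <= 1.
Proof.
move=> ap; have c0 := cyl_len_gt0 n ap.
have /andP[lb ub] := value_bounds b n ap.
by rewrite /tail divr_ge0 ?(ltW c0)// ler_pdivrMr// mul1r.
Qed.

(** The self-similarity that makes the two expansions comparable: they differ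
    only in [flip]. *)
Lemma tailS b p n : adm p -> tail b p n =
  numer p n / digit p n +
  numer p n / ((digit p n - 1) * digit p n) * flip b (tail b p n.+1).
Proof.
move=> ap; have c0 := cyl_len_gt0 n ap.
have r1 := numer_ge1 p n; have rd := digit_ge n ap.
have := value_tail b n.+1 ap; rewrite (value_tail b n ap).
rewrite seriesSr expansion_termE// -addrA => /addrI.
rewrite orientS cyl_lenS.
set c := cyl_len p n in c0 *; set o := orient b n; set d := digit p n in rd *.
set r := numer p n in r1 rd *; set t' := tail b p n.+1.
have o0 : o != 0 by rewrite -normr_gt0 normr_orient.
have d1 : d - 1 != 0 by apply/eqP; lra.
have d0 : d != 0 by apply/eqP; lra.
have c1 : c != 0 by rewrite gt_eqF.
move=> H; apply: (mulfI c1); apply: (mulfI o0); rewrite H /flip.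
by case: (b); field; apply/andP.
Qed.

Lemma tail_bounds b p n : adm p ->
  numer p n / digit p n <= tail b p n <= numer p n / (digit p n - 1).
Proof.
move=> ap; rewrite tailS//.
exact: (step_bounds b (numer_ge1 p n) (digit_ge n ap) (tail01 b n.+1 ap)).
Qed.

Lemma tail_gt0 b p n : adm p -> 0 < tail b p n.
Proof.
move=> ap; have /andP[+ _] := tail_bounds b n ap; apply: lt_le_trans.
have := numer_ge1 p n; have := digit_ge n ap => rd r1.
by rewrite divr_gt0//; lra.
Qed.

Lemma agree_series n b p q : adm p -> adm q -> agree n p q ->
  series (expansion_term b p) n = series (expansion_term b q) n.
Proof.
move=> ap aq e; apply: eq_big_nat => k /andP[_ kn].
have ek := agree_le (ltnW kn) e.
by rewrite !expansion_termE// (agree_cyl_len ek) (agree_numer ek) /digit e.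
Qed.

(** Distances can be computed inside a common cylinder, whose length is the
    same for both expansions. *)
Lemma value_dist n b p q : adm p -> adm q -> agree n p q ->
  `|value b p - value b q| = cyl_len p n * `|tail b p n - tail b q n|.
Proof.
move=> ap aq e; rewrite (value_tail b n ap) (value_tail b n aq).
rewrite (agree_series b ap aq e) (agree_cyl_len e) opprD addrACA subrr add0r.
rewrite -mulrBr -mulrBr !normrM.
by rewrite normr_orient mul1r gtr0_norm ?cyl_len_gt0.
Qed.


(** * Splitting a small set of values *)

Definition close_on b (D : R) (S : set (nat -> posnat)) :=
  forall p q, S p -> S q -> `|value b p - value b q| <= D.

(** Admissible sequences that all belong to the same cylinder of rank [n]. *)
Definition bundle n (S : set (nat -> posnat)) :=
  forall p, S p -> adm p /\ forall q, S q -> agree n p q.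

Lemma bundle_sub n S S' : S' `<=` S -> bundle n S -> bundle n S'.
Proof.
by move=> S'S bS p /S'S/bS[ap ep]; split => // q /S'S/ep.
Qed.

Lemma close_itv b n S (u D : R) : bundle n S ->
  (forall p, S p -> u <= cyl_len p n * tail b p n <= u + D) -> close_on b D S.
Proof.
move=> bS tS p q Sp Sq.
have [ap /(_ q Sq) e] := bS p Sp; have [aq _] := bS q Sq.
rewrite (value_dist b ap aq e) -[X in X * _]gtr0_norm ?cyl_len_gt0//.
rewrite -normrM mulrBr; have := tS p Sp; have := tS q Sq.
by rewrite -(agree_cyl_len e) ler_norml; lra.
Qed.

Lemma close_bottom b n S D : bundle n S ->
  (forall p, S p -> cyl_len p n * tail b p n <= D) -> close_on b D S.
Proof.
move=> bS tS; apply: (close_itv (u := 0) bS) => p Sp; rewrite add0r tS// andbT.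
have [ap _] := bS p Sp.
by rewrite mulr_ge0 ?(ltW (cyl_len_gt0 _ ap)) ?(ltW (tail_gt0 _ _ ap)).
Qed.

Lemma close_top b n S D : bundle n S ->
  (forall p, S p -> cyl_len p n * (1 - tail b p n) <= D) -> close_on b D S.
Proof.
move=> bS tS; have [->|/set0P[p0 Sp0]] := eqVneq S set0; first by move=> ? ? [].
apply: (close_itv (u := cyl_len p0 n - D) bS) => p Sp.
have [ap /(_ p0 Sp0)/agree_cyl_len <-] := bS p Sp.
have := tS p Sp; have := cyl_len_gt0 n ap; have := tail01 b n ap; nra.
Qed.

Lemma edge_ratio (r d : R) : 1 <= r -> r + 1 <= d -> r / (d - 1) <= 2 * (r / d).
Proof.
move=> r1 rd; rewrite mulrCA; apply: ler_wpM2l; first by lra.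
rewrite ler_pdivlMr; last by lra.
by rewrite mulrC ler_pdivrMr; lra.
Qed.

Lemma gap_ratio (r d : R) : 1 <= r -> r + 2 <= d ->
  1 - r / d <= 2 * (1 - r / (d - 1)).
Proof.
move=> r1 rd.
have -> : 1 - r / d = (d - r) / d by field; apply/eqP; lra.
have -> : 1 - r / (d - 1) = (d - 1 - r) / (d - 1) by field; apply/eqP; lra.
apply: (@le_trans _ _ ((d - r) / (d - 1))).
  by rewrite ler_wpM2l ?lef_pV2 ?posrE; lra.
by rewrite mulrA ler_wpM2r ?invr_ge0; lra.
Qed.

Section Covering.
Variables b b' : bool.

(** [tail] lies between r / d and r / (d - 1) in both expansions, and these
    bounds differ by a factor at most 2. *)
Lemma near_bottom n S D : bundle n S ->
  (forall p, S p -> cyl_len p n * tail b p n <= D) -> close_on b' (2 * D) S.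
Proof.
move=> bS tS; apply: (close_bottom bS) => p Sp; have [ap _] := bS p Sp.
apply: (le_trans _ (_ : 2 * (cyl_len p n * tail b p n) <= _)); last first.
  by rewrite ler_pM2l// tS.
have c0 := cyl_len_gt0 n ap; rewrite [leRHS]mulrCA ler_wpM2l ?(ltW c0)//.
have /andP[_ /le_trans->//] := tail_bounds b' n ap.
have /andP[lb _] := tail_bounds b n ap.
apply: (le_trans _ (_ : 2 * (numer p n / digit p n) <= _)); last by lra.
exact: edge_ratio (numer_ge1 p n) (digit_ge n ap).
Qed.

(** Bounds for [1 - tail] are 1 - r / (d - 1) and 1 - r / d; they are comparable
    unless d = r + 1, where the first one vanishes. *)
Lemma near_top_step n p D : adm p -> cyl_len p n * (1 - tail b p n) <= D ->
  numer p n + 2 <= digit p n -> cyl_len p n * (1 - tail b' p n) <= 2 * D.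
Proof.
move=> ap tD rd; have r1 := numer_ge1 p n; have c0 := cyl_len_gt0 n ap.
apply: (le_trans _ (_ : 2 * (cyl_len p n * (1 - tail b p n)) <= _)); last first.
  by rewrite ler_pM2l.
rewrite [leRHS]mulrCA ler_wpM2l ?(ltW c0)//.
have /andP[lb _] := tail_bounds b' n ap; have /andP[_ ub] := tail_bounds b n ap.
apply: (@le_trans _ _ (1 - numer p n / digit p n)); first by lra.
apply: (@le_trans _ _ (2 * (1 - numer p n / (digit p n - 1)))); last by lra.
exact: gap_ratio.
Qed.

Lemma min_digitP p n : adm p ->
  (p n == (perron_r phi p n).+1 :> nat) \/ numer p n + 2 <= digit p n.
Proof.
move=> /(_ n); rewrite addn1 leq_eqVlt => /predU1P[->|h]; first by left.
by right; rewrite /numer /digit -natrD ler_nat addn2.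
Qed.

Lemma min_digitE p n : p n == (perron_r phi p n).+1 :> nat ->
  digit p n = numer p n + 1.
Proof. by rewrite /digit /numer => /eqP->; rewrite natr1. Qed.

Definition min_digit n : set (nat -> posnat) :=
  [set p : nat -> posnat | p n == (perron_r phi p n).+1 :> nat].

Lemma bundle_min n S : bundle n S -> S `<=` min_digit n -> bundle n.+1 S.
Proof.
move=> bS mS p Sp; have [ap ep] := bS p Sp; split => // q Sq.
apply: agreeS (ep q Sq) _; apply: posnat_inj.
by rewrite (eqP (mS p Sp)) (eqP (mS q Sq)) (agree_r (ep q Sq)).
Qed.

Lemma cyl_lenS_min p n : adm p -> min_digit n p ->
  cyl_len p n.+1 = cyl_len p n / (numer p n + 1).
Proof.
move=> ap /min_digitE mp; rewrite cyl_lenS mp addrK.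
by have := numer_ge1 p n => r1; field; apply/andP; split; apply/eqP; lra.
Qed.

Lemma tailS_min c p n : adm p -> min_digit n p ->
  cyl_len p n * (1 - tail c p n) =
  cyl_len p n.+1 * (1 - flip c (tail c p n.+1)).
Proof.
move=> ap mp; rewrite cyl_lenS_min// tailS// (min_digitE mp) addrK.
by have := numer_ge1 p n => r1; field; apply/andP; split; apply/eqP; lra.
Qed.


Lemma close_set0 c D : close_on c D set0. Proof. by move=> ? ? []. Qed.

(** In the alternating expansion the top of a cylinder is also the top of its
    subcylinder with minimal digit, and a reversed subcylinder has its starting
    end there: inside it, near the top becomes near the bottom. *)
Lemma near_top_alt n S D : b = true -> bundle n S ->
  (forall p, S p -> cyl_len p n * (1 - tail b p n) <= D) ->
  close_on b' (2 * D) (S `&` min_digit n) /\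
  close_on b' (2 * D) (S `\` min_digit n).
Proof.
move=> bT bS tS; split.
  have bS1 : bundle n.+1 (S `&` min_digit n).
    by apply: bundle_min => [|? []//]; exact: bundle_sub bS.
  apply: (near_bottom bS1) => p [Sp mp]; have := tS p Sp.
  by rewrite tailS_min//; [rewrite bT /flip subKr|case: (bS p Sp)].
have bS2 : bundle n (S `\` min_digit n) by exact: bundle_sub bS.
apply: (close_top bS2) => p [Sp mp]; have [ap _] := bS p Sp.
by case: (min_digitP n ap) => // rd; apply: near_top_step => //; exact: tS.
Qed.

(** In the positive expansion points near the top may have a long run of minimal
    digits.  As long as the subcylinder with minimal digit is longer than [D],
    every point within [D] of the top belongs to it and the rank can be
    increased.  The first subcylinder of length at most [D] ends the descent:
    its points are within [D] of the top in any expansion, and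
    [near_top_step] applies to the others. *)
Lemma near_top_pos n S D : b = false -> 0 < D -> bundle n S ->
  (forall p, S p -> cyl_len p n * (1 - tail b p n) <= D) ->
  close_on b' (2 * D) S.
Proof.
move=> bF D0 bS tS.
have [N NP] : exists N, 1 <= 2 ^+ N * D.
  exists (Num.truncn D^-1).+1; rewrite -ler_pdivrMr// div1r.
  apply: ltW; apply: lt_le_trans (truncnS_gt _) _.
  by rewrite -natrX ler_nat ltnW// ltn_expl.
have {NP} : forall p, S p -> cyl_len p n <= 2 ^+ N * D.
  move=> p /bS[ap _]; apply: le_trans (cyl_len_le n ap) (le_trans _ NP).
  by apply: exprn_ile1; lra.
(* N bounds the number of ranks left: cylinders shrink at least by half *)
elim: N n S bS tS => [|N ih] n S bS tS cS.
  apply: (close_top bS) => p Sp; have [ap _] := bS p Sp.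
  have := cS p Sp; rewrite expr0 mul1r.
  by have := tail_gt0 b' n ap; have := cyl_len_gt0 n ap; nra.
have [[p0 Sp0 cp0]|nc] :=
    pselect (exists2 p, S p & cyl_len p n <= D * (numer p n + 1)).
  apply: (close_top bS) => p Sp; have [ap /(_ p0 Sp0) e] := bS p Sp.
  case: (min_digitP n ap) => [mp|rd]; last exact: near_top_step (tS p Sp) rd.
  rewrite tailS_min// cyl_lenS_min// (agree_cyl_len e) (agree_numer e).
  have r1 := numer_ge1 p0 n; have := tail01 b' n.+1 ap.
  have [ap0 _] := bS p0 Sp0; have c0 := cyl_len_gt0 n ap0.
  have : cyl_len p0 n / (numer p0 n + 1) <= D by rewrite ler_pdivrMr//; lra.
  have : 0 <= cyl_len p0 n / (numer p0 n + 1) by rewrite divr_ge0//; lra.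
  by rewrite /flip; case: (b') => ? ? ?; nra.
have mS : S `<=` min_digit n.
  move=> p Sp; have [ap _] := bS p Sp.
  case: (min_digitP n ap) => // rd; exfalso; apply: nc; exists p => //.
  have r1 := numer_ge1 p n; rewrite -ler_pdivrMr; last by lra.
  apply: le_trans (tS p Sp); rewrite ler_wpM2l ?(ltW (cyl_len_gt0 _ ap))//.
  have /andP[_ ub] := tail_bounds b n ap.
  suff : numer p n / (digit p n - 1) <= 1 - (numer p n + 1)^-1 by lra.
  have -> : 1 - (numer p n + 1)^-1 = numer p n / (numer p n + 1).
    by field; apply/eqP; lra.
  by rewrite ler_wpM2l ?lef_pV2 ?posrE; lra.
apply: (ih n.+1 S (bundle_min bS mS)) => p Sp; have [ap _] := bS p Sp.
  by have := tS p Sp; rewrite tailS_min//; [rewrite bF|exact: mS].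
apply: le_trans (cyl_lenS_half n ap) _.
by have := cS p Sp; rewrite exprS; lra.
Qed.

Lemma near_top n S D : 0 < D -> bundle n S ->
  (forall p, S p -> cyl_len p n * (1 - tail b p n) <= D) ->
  exists S1 S2, [/\ S `<=` S1 `|` S2, close_on b' (2 * D) S1 &
                    close_on b' (2 * D) S2].
Proof.
move=> D0 bS tS; have [bT|/negbTE bF] := boolP b.
  exists (S `&` min_digit n), (S `\` min_digit n).
  have [c1 c2] := near_top_alt bT bS tS; split => //.
  by move=> p Sp; have [|] := pselect (min_digit n p); [left|right].
exists S, set0; split; [by left|exact: near_top_pos tS|exact: close_set0].
Qed.

(** The stretch spanned by the cylinders of two digits that differ by at least 2
    is at most 6 times the gap between them: the numerators satisfy
    d - a + 1 <= 3 (d - 1 - a), the denominators a (d - 1) <= 2 (a - 1) d. *)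
Lemma far_ratio (a d : R) : 2 <= a -> a + 2 <= d ->
  (a - 1)^-1 - d^-1 <= 6 * (a^-1 - (d - 1)^-1).
Proof.
move=> a2 ad.
have -> : (a - 1)^-1 - d^-1 = (d - (a - 1)) / ((a - 1) * d).
  by field; apply/andP; split; apply/eqP; lra.
have -> : a^-1 - (d - 1)^-1 = (d - 1 - a) / (a * (d - 1)).
  by field; apply/andP; split; apply/eqP; lra.
apply: (@le_trans _ _ ((3 * (d - 1 - a)) / ((a - 1) * d))).
  by apply: ler_wpM2r; [rewrite invr_ge0 mulr_ge0//; lra|lra].
have -> : 6 * ((d - 1 - a) / (a * (d - 1))) =
    (3 * (d - 1 - a)) * (2 / (a * (d - 1))).
  by field; apply/andP; split; apply/eqP; lra.
apply: ler_wpM2l; first by lra.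
rewrite ler_pdivlMr; last by rewrite mulr_gt0//; lra.
rewrite mulrC ler_pdivrMr; last by rewrite mulr_gt0//; lra.
by nra.
Qed.


Lemma close_on_le c D D' S : D <= D' -> close_on c D S -> close_on c D' S.
Proof. by move=> DD cS p q Sp Sq; apply: le_trans (cS p q Sp Sq) DD. Qed.

Lemma first_disagreement S : (forall p q, S p -> S q -> p = q) \/
  exists n, (forall p q, S p -> S q -> agree n p q) /\
            exists p q, [/\ S p, S q & p n <> q n].
Proof.
have [|ns] := pselect (forall p q, S p -> S q -> p = q); [by left|right].
pose P n := `[< exists p q, [/\ S p, S q & p n <> q n] >].
have exP : exists n, P n.
  apply: contrapT => nP; apply: ns => p q Sp Sq; apply/funext => n.
  by apply: contrapT => pq; apply: nP; exists n; apply/asboolP; exists p, q.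
case: (ex_minnP exP) => n /asboolP Pn minn; exists n; split=> // p q Sp Sq k kn.
apply: contrapT => pq; have : P k by apply/asboolP; exists p, q.
by move=> /minn; rewrite leqNgt kn.
Qed.

Lemma least_digit n S p0 : S p0 ->
  exists2 w, S w & forall p, S p -> (w n <= p n)%N.
Proof.
move=> Sp0; pose P k := `[< exists2 p, S p & p n = k :> nat >].
have exP : exists k, P k by exists (p0 n); apply/asboolP; exists p0.
case: (ex_minnP exP) => k /asboolP[w Sw wk] mink; exists w => // p Sp.
by rewrite wk; apply: mink; apply/asboolP; exists p.
Qed.

Lemma cyl_tail_step c p n : adm p -> cyl_len p n * tail c p n =
  cyl_len p n * numer p n / digit p n + cyl_len p n.+1 * flip c (tail c p n.+1).
Proof. by move=> ap; rewrite tailS// cyl_lenS; ring. Qed.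

Lemma digit_ge2 p n : adm p -> 2 <= digit p n.
Proof. by move=> ap; have := digit_ge n ap; have := numer_ge1 p n; lra. Qed.

(** The cylinders of larger digits are lower, so the whole set lies below the
    upper end of the cylinder of the least digit [w n]; each digit
    [>= w n + 2] gives a lower bound by [far_ratio], and [v] takes care of the
    digits [w n] and [w n + 1]. *)
Lemma far_close n S w v d : bundle n S -> close_on b d S -> S w -> S v ->
  (forall p, S p -> (w n <= p n)%N) -> (w n + 2 <= v n)%N ->
  close_on b' (6 * d) S.
Proof.
move=> bS cS Sw Sv minw wv; have [aw _] := bS w Sw.
set x := cyl_len w n * numer w n.
have x0 : 0 < x.
  by rewrite mulr_gt0 ?cyl_len_gt0//; have := numer_ge1 w n; lra.
have a2 := digit_ge2 n aw.
have xE p : S p -> cyl_len p n * numer p n = x.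
  by move=> /bS[_ /(_ w Sw) e]; rewrite /x (agree_cyl_len e) (agree_numer e).
have tb c p : S p ->
    x / digit p n <= cyl_len p n * tail c p n <= x / (digit p n - 1).
  move=> Sp; have [ap _] := bS p Sp; rewrite -(xE p Sp) -!mulrA.
  have /andP[lb ub] := tail_bounds c n ap.
  by rewrite !ler_wpM2l// (ltW (cyl_len_gt0 n ap)).
have far p : S p -> (w n + 2 <= p n)%N ->
    x / (digit w n - 1) - 6 * d <= x / digit p n.
  move=> Sp wp; have wp' : digit w n + 2 <= digit p n by rewrite -natrD ler_nat.
  have := far_ratio a2 wp'; rewrite -(ler_pM2l x0) => H.
  have := cS w p Sw Sp; have [ap _] := bS p Sp.
  have e : agree n w p by exact: (bS w Sw).2.
  rewrite (value_dist b aw ap e).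
  rewrite -[X in X * _]gtr0_norm ?cyl_len_gt0// -normrM mulrBr.
  move=> /(le_trans (ler_norm _)); rewrite {2}(agree_cyl_len e) => H1.
  have /andP[l1 _] := tb b w Sw; have /andP[_ l2] := tb b p Sp.
  by move: H; rewrite mulrBr [leRHS]mulrCA mulrBr; lra.
apply: (close_itv (u := x / (digit w n - 1) - 6 * d) bS) => p Sp.
have /andP[lb ub] := tb b' p Sp; rewrite subrK; apply/andP; split.
  apply: le_trans _ lb.
  have [wp|pw] := leqP (w n + 2)%N (p n); first exact: far.
  apply: le_trans (far v Sv wv) _; rewrite ler_wpM2l ?(ltW x0)//.
  have := digit_ge2 n (bS p Sp).1; have := digit_ge2 n (bS v Sv).1 => ? ?.
  rewrite lef_pV2 ?posrE; [|lra|lra].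
  by rewrite ler_nat; apply: leq_trans wv; exact: ltnW.
apply: le_trans ub _; rewrite ler_wpM2l ?(ltW x0)//.
have pw : digit w n <= digit p n by rewrite ler_nat minw.
by rewrite lef_pV2 ?posrE; lra.
Qed.

(** The left part [Sl] and the right part [Sr] of the proof have the digits
    [w n] and [w n + 1].  Their cylinders meet at the lower end of the first
    one, and the distance of a point of [Sl] to a point of [Sr] is the sum of
    their distances to the common end.  In the positive expansion [Sl] is near
    the bottom and [Sr] near the top of its cylinder; in the alternating one it
    is the other way round. *)
Lemma near_close n S w v d : bundle n S -> close_on b d S -> S w -> S v ->
  v n = (w n).+1 :> nat -> (forall p, S p -> p n = w n \/ p n = v n) ->
  exists S1 S2 S3, [/\ S `<=` S1 `|` S2 `|` S3, close_on b' (2 * d) S1,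
    close_on b' (2 * d) S2 & close_on b' (2 * d) S3].
Proof.
move=> bS cS Sw Sv vw wv.
pose Sl := S `&` [set p | p n = w n]; pose Sr := S `&` [set p | p n = v n].
have bl : bundle n.+1 Sl.
  move=> p [Sp pn]; have [ap ep] := bS p Sp; split => // q [Sq qn].
  by apply: agreeS; [exact: ep|rewrite pn qn].
have br : bundle n.+1 Sr.
  move=> p [Sp pn]; have [ap ep] := bS p Sp; split => // q [Sq qn].
  by apply: agreeS; [exact: ep|rewrite pn qn].
have Slr : S `<=` Sl `|` Sr by move=> p Sp; case: (wv p Sp); [left|right].
have sum p q : Sl p -> Sr q ->
    cyl_len p n.+1 * flip b (tail b p n.+1)
    + cyl_len q n.+1 * (1 - flip b (tail b q n.+1)) <= d.
  move=> [Sp pn] [Sq qn]; have [ap ep] := bS p Sp; have [aq _] := bS q Sq.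
  have := cS p q Sp Sq; have e := ep q Sq; rewrite (value_dist b ap aq e).
  rewrite -[X in X * _]gtr0_norm ?cyl_len_gt0// -normrM mulrBr.
  rewrite {2}(agree_cyl_len e) => /(le_trans (ler_norm _)).
  rewrite !cyl_tail_step//.
  suff : cyl_len q n.+1 = cyl_len p n * numer p n / digit p n -
      cyl_len q n * numer q n / digit q n by lra.
  rewrite cyl_lenS (agree_cyl_len e) (agree_numer e).
  have -> : digit q n = digit p n + 1 by rewrite /digit qn pn vw natr1.
  have := digit_ge2 n ap => p2; rewrite addrK.
  by field; apply/andP; split; apply/eqP; lra.
have fl p m : adm p -> 0 <= cyl_len p m * flip b (tail b p m).
  move=> ap; rewrite mulr_ge0 ?(ltW (cyl_len_gt0 _ _))//.
  by have := tail01 b m ap; rewrite /flip; case: (b); lra.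
have fr p m : adm p -> 0 <= cyl_len p m * (1 - flip b (tail b p m)).
  move=> ap; rewrite mulr_ge0 ?(ltW (cyl_len_gt0 _ _))//.
  by have := tail01 b m ap; rewrite /flip; case: (b); lra.
have Slw : Sl w by []; have Srv : Sr v by [].
have [aw _] := bS w Sw; have [av _] := bS v Sv.
have hl p : Sl p -> cyl_len p n.+1 * flip b (tail b p n.+1) <= d.
  by move=> Slp; have := sum p v Slp Srv; have := fr v n.+1 av; lra.
have hr q : Sr q -> cyl_len q n.+1 * (1 - flip b (tail b q n.+1)) <= d.
  by move=> Srq; have := sum w q Slw Srq; have := fl w n.+1 aw; lra.
(* no value is the starting end of its cylinder, so that the set near the
   bottom shows 0 < d, as [near_top] requires *)
have pos p m : adm p -> 0 < cyl_len p m * tail b p m.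
  by move=> ap; rewrite mulr_gt0 ?cyl_len_gt0 ?tail_gt0.
have [bT|/negbTE bF] := boolP b.
  have hr' q : Sr q -> cyl_len q n.+1 * tail b q n.+1 <= d.
    by move=> /hr; rewrite {1}bT /flip subKr.
  have d0 : 0 < d by apply: lt_le_trans (hr' v Srv); exact: pos.
  have hl' q : Sl q -> cyl_len q n.+1 * (1 - tail b q n.+1) <= d.
    by move=> /hl; rewrite {1}bT.
  have [S1 [S2 [S12 c1 c2]]] := near_top d0 bl hl'.
  exists S1, S2, Sr; split => //; last exact: near_bottom hr'.
  by move=> p /Slr[/S12|]; [left|right].
have hl' q : Sl q -> cyl_len q n.+1 * tail b q n.+1 <= d.
  by move=> /hl; rewrite {1}bF.
have d0 : 0 < d by apply: lt_le_trans (hl' w Slw); exact: pos.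
have hr' q : Sr q -> cyl_len q n.+1 * (1 - tail b q n.+1) <= d.
  by move=> /hr; rewrite {1}bF.
have [S1 [S2 [S12 c1 c2]]] := near_top d0 br hr'.
exists S1, S2, Sl; split => //; last exact: near_bottom hl'.
by move=> p /Slr[|/S12]; [right|left].
Qed.

Lemma cover_transfer S d : 0 <= d -> S `<=` adm -> close_on b d S ->
  exists S1 S2 S3, [/\ S `<=` S1 `|` S2 `|` S3, close_on b' (6 * d) S1,
    close_on b' (6 * d) S2 & close_on b' (6 * d) S3].
Proof.
move=> d0 aS cS.
have [eqS|[n [eS [p0 [q0 [Sp0 Sq0 pq]]]]]] := first_disagreement S.
  exists S, set0, set0; split; try exact: close_set0; first by left; left.
  by move=> p q Sp Sq; rewrite (eqS p q)// subrr normr0; lra.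
have bS : bundle n S by move=> p Sp; split; [exact: aS|move=> q; exact: eS].
have [w Sw minw] := least_digit n Sp0.
have [[v Sv wv]|nv] := pselect (exists2 v, S v & (w n + 2 <= v n)%N).
  exists S, set0, set0; split; try exact: close_set0; first by left; left.
  exact: far_close wv.
have two p : S p -> p n <> w n -> p n = (w n).+1 :> nat.
  move=> Sp pw; apply/eqP; rewrite eqn_leq; apply/andP; split.
    by rewrite -ltnS ltnNge -addn2; apply/negP => h; apply: nv; exists p.
  by rewrite ltn_neqAle minw// andbT eq_sym; apply/eqP => /posnat_inj.
have [v Sv vw] : exists2 v, S v & v n <> w n.
  have [pw|] := pselect (p0 n = w n); last by exists p0.
  by exists q0 => // qw; apply: pq; rewrite pw qw.
have wv p : S p -> p n = w n \/ p n = v n.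
  move=> Sp; have [|pw] := pselect (p n = w n); [by left|right].
  by apply: posnat_inj; rewrite (two p Sp pw) (two v Sv vw).
have [S1 [S2 [S3 [S123 c1 c2 c3]]]] := near_close bS cS Sw Sv (two v Sv vw) wv.
have le26 : 2 * d <= 6 * d by lra.
exists S1, S2, S3; split; first exact S123.
- exact (close_on_le le26 c1).
- exact (close_on_le le26 c2).
- exact (close_on_le le26 c3).
Qed.

End Covering.

(** * Uniqueness and existence of the expansions *)

Lemma tail_lt c n p q : adm p -> adm q -> agree n p q -> (p n < q n)%N ->
  tail c q n < tail c p n.
Proof.
move=> ap aq e pq; rewrite (tailS c n ap) (tailS c n aq) (agree_numer e).
have : digit p n + 1 <= digit q n by rewrite natr1 ler_nat.
have p2 := digit_ge2 n ap; have := numer_ge1 q n.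
set r := numer q n; set d := digit p n in p2 *; set d' := digit q n => r1 dd.
have l0 : 0 < r / ((d - 1) * d) by rewrite divr_gt0 ?mulr_gt0//; lra.
have l0' : 0 < r / ((d' - 1) * d') by rewrite divr_gt0 ?mulr_gt0//; lra.
have rd : r / d' + r / ((d' - 1) * d') <= r / d.
  by rewrite -edge_split ?ler_wpM2l ?lef_pV2 ?posrE; lra.
have := tail_gt0 c n.+1 ap; have := tail_gt0 c n.+1 aq.
have := tail01 c n.+1 ap; have := tail01 c n.+1 aq; rewrite /flip.
move: (tail c p n.+1) (tail c q n.+1) => t t' ? ? ? ?.
by case: c; nra.
Qed.

Lemma value_inj c p q : adm p -> adm q -> value c p = value c q -> p = q.
Proof.
move=> ap aq vpq.
have [|[n [e [p1 [q1 [S1 S2 pq]]]]]] := first_disagreement [set p; q].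
  by apply; [left|right].
have epq : agree n p q by apply: e; [left|right].
have tE : tail c p n = tail c q n.
  apply/eqP; rewrite -subr_eq0 -normr_eq0.
  have /eqP := value_dist c ap aq epq.
  by rewrite vpq subrr normr0 eq_sym mulf_eq0 gt_eqF ?cyl_len_gt0.
have {S1 S2 pq p1 q1} pq : p n <> q n.
  by case: S1 S2 pq => -> [] -> // + /esym.
case: (ltngtP (p n) (q n)) => [lt|gt|/posnat_inj//].
  by have := tail_lt c ap aq epq lt; rewrite tE ltxx.
by have := tail_lt c aq ap (agree_sym epq) gt; rewrite tE ltxx.
Qed.

Lemma value_gt0 c p : adm p -> 0 < value c p.
Proof. by move=> ap; rewrite -tail0// tail_gt0. Qed.

Lemma value_le1 c p : adm p -> value c p <= 1.
Proof. by move=> ap; rewrite -tail0//; case/andP: (tail01 c 0 ap). Qed.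

Lemma alt_value_lt1 p : adm p -> value true p < 1.
Proof.
move=> ap; rewrite -tail0// tailS//= mulrBr mulr1 addrA.
have r1 := numer_ge1 p 0; have rd := digit_ge 0 ap.
have l0 : 0 < numer p 0 / ((digit p 0 - 1) * digit p 0).
  by rewrite divr_gt0 ?mulr_gt0//; lra.
have := mulr_gt0 l0 (tail_gt0 true 1 ap); have := div_le1 r1 rd.
by rewrite edge_split; lra.
Qed.

Lemma sum_value c p x :
  series (expansion_term c p) @ \oo --> x -> value c p = x.
Proof. by apply: cvg_lim; exact: Rhausdorff. Qed.

Lemma perron_digits_value p : adm p -> perron_digits phi (value false p) = p.
Proof.
move=> ap; rewrite /perron_digits; case: xgetP => [q _ [aq cq]|/(_ p)[]].
  by apply: (value_inj aq ap); exact: (sum_value (c := false) cq).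
by split => //; exact: (value_cvg (b := false) ap).
Qed.

Lemma alt_perron_digits_value p : adm p ->
  alt_perron_digits phi (value true p) = p.
Proof.
move=> ap; rewrite /alt_perron_digits; case: xgetP => [q _ [aq cq]|/(_ p)[]].
  by apply: (value_inj aq ap); exact: (sum_value (c := true) cq).
by split => //; exact: (value_cvg (b := true) ap).
Qed.

(** The digit d with r / d < t <= r / (d - 1). *)
Definition greedy_digit n (w : n.-tuple posnat) (t : R) : posnat :=
  exist (fun k => (0 < k)%N) (Num.truncn ((phi w)%:R / t)).+1 isT.

(** The position that remains after this digit, obtained by solving the equation
    of [tailS] for the next tail of a positive expansion. *)
Definition greedy_rest (r d t : R) : R := (t - r / d) / (r / ((d - 1) * d)).

(** The prefix produced so far is part of the state because the next numerator
    depends on it. *)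
Fixpoint greedy_state (x : R) n : n.-tuple posnat * R :=
  if n is m.+1 then
    let: (w, t) := greedy_state x m in
    let d := greedy_digit w t in
    (rcons_tuple w d, greedy_rest (phi w)%:R d%:R t)
  else ([tuple], x).

Definition greedy x n : posnat :=
  greedy_digit (greedy_state x n).1 (greedy_state x n).2.

Lemma greedy_prefix x n :
  [tuple greedy x i | i < n] = (greedy_state x n).1.
Proof.
suff H i : (i < n)%N -> nth posnat1 (greedy_state x n).1 i = greedy x i.
  by apply: eq_from_tnth => i; rewrite tnth_mktuple (tnth_nth posnat1) H.
elim: n => [//|n ih].
have -> : val (greedy_state x n.+1).1 = rcons (greedy_state x n).1 (greedy x n).
  by rewrite /greedy /=; case: (greedy_state x n).
rewrite ltnS nth_rcons size_tuple leq_eqVlt => /predU1P[->|lin].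
  by rewrite ltnn eqxx.
by rewrite lin ih.
Qed.

Lemma greedy_r x n : perron_r phi (greedy x) n = phi (greedy_state x n).1.
Proof. by rewrite /perron_r greedy_prefix. Qed.

Lemma greedy_stateS x n : (greedy_state x n.+1).2 =
  greedy_rest (numer (greedy x) n) (digit (greedy x) n) (greedy_state x n).2.
Proof.
rewrite /numer /digit greedy_r /greedy /=.
by case: (greedy_state x n).
Qed.

Lemma greedy_step x n : 0 < (greedy_state x n).2 <= 1 ->
  [/\ numer (greedy x) n + 1 <= digit (greedy x) n,
      0 < (greedy_state x n.+1).2 <= 1 &
      (greedy_state x n).2 = numer (greedy x) n / digit (greedy x) n +
        numer (greedy x) n / ((digit (greedy x) n - 1) * digit (greedy x) n) *
        (greedy_state x n.+1).2].
Proof.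
rewrite greedy_stateS; set t := (greedy_state x n).2 => /andP[t0 t1].
have r1 := numer_ge1 (greedy x) n; set r := numer _ n in r1 *.
have rE : r = (phi (greedy_state x n).1)%:R by rewrite /r /numer greedy_r.
have dE : digit (greedy x) n = (Num.truncn (r / t)).+1%:R by rewrite rE.
have rt0 : 0 <= r / t by rewrite divr_ge0//; lra.
have lo : digit (greedy x) n - 1 <= r / t.
  by rewrite dE -natr1 addrK; case/andP: (truncn_itv rt0).
have hi : r / t < digit (greedy x) n by rewrite dE truncnS_gt.
have rd : r + 1 <= digit (greedy x) n.
  rewrite dE rE natr1 ler_nat ltnS -rE truncn_ge_nat// -rE.
  by rewrite ler_pdivlMr//; nra.
set d := digit _ _ in lo hi rd *.
have l0 : 0 < r / ((d - 1) * d) by rewrite divr_gt0 ?mulr_gt0//; lra.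
have lo' : t <= r / (d - 1).
  by move: lo; rewrite ler_pdivlMr// => lo; rewrite ler_pdivlMr; lra.
have hi' : r / d < t.
  by move: hi; rewrite ltr_pdivrMr// => hi; rewrite ltr_pdivrMr; lra.
split => //; rewrite /greedy_rest; last first.
  by rewrite [X in _ = _ + X]mulrC divfK ?gt_eqF// addrC subrK.
rewrite divr_gt0 ?subr_gt0//= ler_pdivrMr// mul1r.
by move: lo'; rewrite edge_split; lra.
Qed.

Lemma greedy_state01 x n : 0 < x <= 1 -> 0 < (greedy_state x n).2 <= 1.
Proof. by move=> x01; elim: n => [//|n /greedy_step[]]. Qed.

Lemma greedy_adm x : 0 < x <= 1 -> adm (greedy x).
Proof.
move=> x01 n; have [+ _ _] := greedy_step (greedy_state01 n x01).
by rewrite /numer /digit natr1 ler_nat addn1.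
Qed.

Lemma greedy_value x : 0 < x <= 1 -> value false (greedy x) = x.
Proof.
move=> x01; have ap := greedy_adm x01; set p := greedy x in ap *.
have xE n : x = series (expansion_term false p) n +
    cyl_len p n * (greedy_state x n).2.
  elim: n => [|n ih].
    by rewrite /series/= big_geq// /cyl_len big_ord0 add0r mul1r.
  rewrite {1}ih seriesSr expansion_termE// cyl_lenS /orient mul1r -addrA.
  have [_ _ {1}->] := greedy_step (greedy_state01 n x01).
  by rewrite mulrDr [X in _ + (_ + X) = _]mulrA.
apply: (sum_value (c := false)); rewrite -[x in _ --> x]subr0.
have -> : series (expansion_term false p) =
    fun n => x - cyl_len p n * (greedy_state x n).2.
  by apply/funext => n; rewrite {1}(xE n) addrK.
apply: cvgB; first exact: cvg_cst.
apply: (@squeeze_cvgr _ _ _ _ (fun=> 0) (cyl_len p)).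
- near=> n; have := greedy_state01 n x01; have := cyl_len_gt0 n ap.
  by move: (cyl_len p n) (greedy_state x n).2 => c t ? ?; nra.
- exact: cvg_cst.
- exact: cyl_len_cvg0.
Unshelve. all: by end_near. Qed.

Lemma perron_set_image M :
  [set x : R | 0 < x <= 1 /\ M (perron_digits phi x)] =
  value false @` (adm `&` M).
Proof.
apply/seteqP; split => [x [x01]|_ [p [ap Mp] <-]] /=; last first.
  by rewrite perron_digits_value// value_gt0// value_le1.
rewrite -{1}(greedy_value x01) perron_digits_value; last exact: greedy_adm.
move=> Mx; exists (greedy x); last exact: greedy_value.
by split => //; exact: greedy_adm.
Qed.

Lemma alt_perron_set_image M :
  [set x : R | [/\ 0 < x < 1, ~ alt_perron_IS phi x &
                   M (alt_perron_digits phi x)]] =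
  value true @` (adm `&` M).
Proof.
apply/seteqP; split => [x [/andP[x0 x1] nIS]|_ [p [ap Mp] <-]] /=; last first.
  rewrite alt_perron_digits_value// value_gt0// alt_value_lt1//; split => //.
  move=> [_]; apply; exists p; split => //.
  exact: (value_cvg (b := true) ap).
have [q [aq cq]] : exists q, is_alt_perron_repr phi x q.
  by apply: contrapT => nq; apply: nIS; split; [rewrite x0 ltW|].
have <- : value true q = x by exact: (sum_value (c := true) cq).
by rewrite alt_perron_digits_value// => Mq; exists q.
Qed.

(** * Equality of the dimensions *)

Lemma hausdorff_null_value c c' M s : 0 <= s ->
  hausdorff_measure s (value c @` (adm `&` M)) = 0%E ->
  hausdorff_measure s (value c' @` (adm `&` M)) = 0%E.
Proof.
move=> s0; apply: (@hausdorff_null_transfer _ _ _ _ _ 2 6) => // S d d0 SD cS.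
have [|S1 [S2 [S3 [S123 c1 c2 c3]]]] := @cover_transfer c c' S d d0 _ cS.
  by move=> p /SD[].
exists (nth set0 [:: S1; S2; S3]); split.
  by move=> p /S123[[Sp|Sp]|Sp]; [exists 0%N|exists 1%N|exists 2%N].
move=> [|[|[|j]]] p q /=; [exact: c1|exact: c2|exact: c3|].
by rewrite nth_nil.
Qed.

End PerronValues.

Theorem mainTheorem1 (R : realType) (phi : forall n : nat, n.-tuple posnat -> posnat)
    (M : set (nat -> posnat)) :
  hausdorff_dim [set x : R | 0 < x <= 1 /\ M (perron_digits phi x)] =
  hausdorff_dim [set x : R | [/\ 0 < x < 1, ~ alt_perron_IS phi x &
                                 M (alt_perron_digits phi x)]].
Proof.
rewrite perron_set_image alt_perron_set_image /hausdorff_dim.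
congr (ereal_inf (_ @` _)); apply/seteqP.
by split=> s [s0 H]; split => //; exact: hausdorff_null_value H.
Qed.
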